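(* Consider the problem \[ (\mathcal{P}) \quad \text{minimize } f_0(x) = g_0(x) - h_0(x) \quad \text{subject to } F(x) = G(x) - H(x) \preceq_K 0, \quad x \in Q. \] Let $K$ be finite dimensional and suppose there exists $c \ge 0$ such that the penalty function $\Phi_c(\cdot) = f_0(\cdot) + c \operatorname{dist}(F(\cdot), -K)$ is coercive on $Q$. Suppose also that the sequence $\{x_n\}$ generated by the exact penalty DCA (described in the context) with $\varkappa = 0$ and $\tau_{\max} = +\infty$ converges to a point $x_*$ satisfying the following constraint qualification: \[ 0 \in \operatorname{int}\big\{ G(x) - H(x_* ) - D H(x_* )(x - x_* ) + K \bigm| x \in Q \big\}. \] Then the sequence $\{t_n\}$ is bounded, there exists $m \in \mathbb{N}$ such that for all $n \ge m$ the point $x_n$ is feasible for $(\mathcal{P})$, and the point $x_*$ is feasible and critical for $(\mathcal{P})$.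
   Context: $g_0, h_0 \colon \mathbb{R}^d \to \mathbb{R}$ are real-valued closed convex functions; $\partial$ is the convex subdifferential. $Y$ is a real Banach space with dual $Y^*$, $K \subset Y$ is a proper cone (a closed convex cone with $K \cap (-K) = \{0\}$), $x \preceq_K y$ iff $y - x \in K$, $K^* = \{ y^* \in Y^* \mid \langle y^*, y \rangle \ge 0 \ \forall y \in K \}$; $t \succ_{K^*} 0$ means $t \in K^*$ and $\langle t, y \rangle > 0$ for all $y \in K \setminus \{0\}$. The maps $G, H \colon \mathbb{R}^d \to Y$ are $K$-convex ($G(\alpha x_1 + (1-\alpha)x_2) \preceq_K \alpha G(x_1) + (1-\alpha) G(x_2)$ for all $\alpha \in [0,1]$, $x_1,x_2\in\mathbb{R}^d$; similarly for $H$), $H$ is continuously Fréchet differentiable with derivative $DH$, and $Q \subseteq \mathbb{R}^d$ is a closed convex set. A function $\varphi \colon \mathbb{R}^d \to \mathbb{R}$ is coercive on $Q$ if $\varphi(x_n) \to +\infty$ for any sequence $\{x_n\} \subset Q$ with $\|x_n\| \to +\infty$. Exact penalty DCA. Initialization: choose $x_0 \in Q$, $t_0 \succ_{K^*} 0$, a maximal norm of the penalty parameter $\tau_{\max} \in (0, +\infty]$, $\mu > 1$, infeasibility tolerance $\varkappa \ge 0$; $n = 0$. Step 1: compute some $v_n \in \partial h_0(x_n)$ and $DH(x_n)$. Step 2: let $(x_{n+1}, s_{n+1})$ be an optimal solution (assumed to exist) of the convex problem: minimize over $(x,s)$ $g_0(x) - \langle v_n, x \rangle + \langle t_n, s \rangle$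 subject to $G(x) - H(x_n) - D H(x_n)(x - x_n) \preceq_K s$, $s \succeq_K 0$, $x \in Q$. Step 3: set $t_{n+1} = \mu t_n$ if $\|s_{n+1}\| > \varkappa$ and $\mu \|t_n\| \le \tau_{\max}$, and $t_{n+1} = t_n$ otherwise; set $n := n+1$ and go to Step 1. (The statement concerns the infinite sequence obtained without stopping.) Criticality: a point $x_*$ feasible for $(\mathcal{P})$ is critical if $\partial h_0(x_* ) \cap ( \partial g_0(x_* ) + N_{\Omega(x_* )}(x_* ) ) \ne \emptyset$, where $\Omega(x_* ) = \{ x \in Q \mid G(x) - H(x_* ) - D H(x_* )(x - x_* ) \preceq_K 0 \}$ and $N_V(x) = \{ v \mid \langle v, z - x \rangle \le 0 \ \forall z \in V \}$. *)

(* Defs.v *)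
From HB Require Import structures.
From mathcomp Require Import all_boot all_order all_algebra.
From mathcomp Require Import all_classical all_reals all_analysis.

Set Implicit Arguments.
Unset Strict Implicit.
Unset Printing Implicit Defensive.

Import Order.TTheory GRing.Theory Num.Theory.
Import numFieldNormedType.Exports.

Local Open Scope classical_set_scope.
Local Open Scope ring_scope.

Definition dot (R : realType) (d : nat) (v x : 'rV[R]_d) : R :=
  \sum_(i < d) v 0 i * x 0 i.

Definition closed_convex_fun (R : realType) (d : nat) (f : 'rV[R]_d -> R) : Prop :=
  convex_function [set: 'rV[R]_d] f /\ lower_semicontinuous (EFin \o f).

Definition subdifferential (R : realType) (d : nat) (f : 'rV[R]_d -> R)
    (x : 'rV[R]_d) : set 'rV[R]_d :=
  [set v | forall z, f x + dot v (z - x) <= f z].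

Definition normal_cone (R : realType) (d : nat) (V : set 'rV[R]_d)
    (x : 'rV[R]_d) : set 'rV[R]_d :=
  [set v | forall z, V z -> dot v (z - x) <= 0].

(* The norm on 'rV[R]_d is the max norm; all norms on R^d being equivalent, it
   gives the same coercive functions and the same convergent sequences. *)
Definition coercive_on (R : realType) (d : nat) (Q : set 'rV[R]_d)
    (f : 'rV[R]_d -> R) : Prop :=
  forall u : nat -> 'rV[R]_d, (forall n, Q (u n)) ->
    `|u n| @[n --> \oo] --> +oo -> f (u n) @[n --> \oo] --> +oo.

Definition proper_cone (R : realType) (Y : normedModType R) (K : set Y) : Prop :=
  [/\ closed K, convex_set K,
      forall (l : R) (y : Y), 0 <= l -> K y -> K (l *: y)
    & K `&` (-%R @` K) = [set 0]].

Definition cone_le (R : realType) (Y : normedModType R) (K : set Y) (y z : Y) : Prop :=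
  K (z - y).

Definition finite_dimensional (R : realType) (Y : normedModType R) (A : set Y) : Prop :=
  exists (n : nat) (b : 'I_n -> Y),
    forall y, A y -> exists c : 'I_n -> R, y = \sum_(i < n) c i *: b i.

(* Elements of the topological dual are linear forms together with a
   continuity hypothesis, which is part of membership in the dual cone. *)
Definition dual_cone (R : realType) (Y : normedModType R) (K : set Y)
    : set {linear Y -> R^o} :=
  [set t | continuous (t : Y -> R) /\ forall y, K y -> 0 <= t y].

Definition dual_cone_pos (R : realType) (Y : normedModType R) (K : set Y)
    (t : {linear Y -> R^o}) : Prop :=
  dual_cone K t /\ forall y, K y -> y <> 0 -> 0 < t y.

Definition dual_norm (R : realType) (Y : normedModType R)
    (t : {linear Y -> R^o}) : R :=
  sup [set `|t y| | y in [set y : Y | `|y| <= 1]].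

Definition cone_convex (R : realType) (d : nat) (Y : normedModType R) (K : set Y)
    (F : 'rV[R]_d -> Y) : Prop :=
  forall (a : R) (x1 x2 : 'rV[R]_d), 0 <= a -> a <= 1 ->
    cone_le K (F (a *: x1 + (1 - a) *: x2)) (a *: F x1 + (1 - a) *: F x2).

(* Continuity of the derivative is with respect to the operator norm. *)
Definition continuously_differentiable (R : realType) (d : nat)
    (Y : normedModType R) (H : 'rV[R]_d -> Y) : Prop :=
  (forall x, differentiable H x) /\
  forall (x : 'rV[R]_d) (e : R), 0 < e ->
    \forall z \near x, forall u, `|'d H z u - 'd H x u| <= e * `|u|.

Definition feasible (R : realType) (d : nat) (Y : normedModType R) (K : set Y)
    (G H : 'rV[R]_d -> Y) (Q : set 'rV[R]_d) : set 'rV[R]_d :=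
  [set x | cone_le K (G x - H x) 0 /\ Q x].

(* [edist_inf] is the extended real distance to a set; it is finite here,
   since the cone contains 0. *)
Definition penalty_function (R : realType) (d : nat) (Y : normedModType R)
    (K : set Y) (g0 h0 : 'rV[R]_d -> R) (G H : 'rV[R]_d -> Y) (c : R)
    (x : 'rV[R]_d) : R :=
  (g0 x - h0 x) + c * fine (edist_inf (-%R @` K) (G x - H x)).

Definition linearized_constraint (R : realType) (d : nat) (Y : normedModType R)
    (G H : 'rV[R]_d -> Y) (x0 x : 'rV[R]_d) : Y :=
  G x - H x0 - 'd H x0 (x - x0).

Definition linearized_feasible (R : realType) (d : nat) (Y : normedModType R)
    (K : set Y) (G H : 'rV[R]_d -> Y) (Q : set 'rV[R]_d) (x0 : 'rV[R]_d)
    : set 'rV[R]_d :=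
  [set x | Q x /\ cone_le K (linearized_constraint G H x0 x) 0].

Definition critical (R : realType) (d : nat) (Y : normedModType R) (K : set Y)
    (g0 h0 : 'rV[R]_d -> R) (G H : 'rV[R]_d -> Y) (Q : set 'rV[R]_d)
    (x : 'rV[R]_d) : Prop :=
  subdifferential h0 x `&`
    [set v + w | v in subdifferential g0 x
               & w in normal_cone (linearized_feasible K G H Q x) x] !=set0.

Definition subproblem_feasible (R : realType) (d : nat) (Y : normedModType R)
    (K : set Y) (G H : 'rV[R]_d -> Y) (Q : set 'rV[R]_d) (x0 : 'rV[R]_d)
    (x : 'rV[R]_d) (s : Y) : Prop :=
  [/\ cone_le K (linearized_constraint G H x0 x) s, cone_le K 0 s & Q x].

Definition subproblem_objective (R : realType) (d : nat) (Y : normedModType R)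
    (g0 : 'rV[R]_d -> R) (v : 'rV[R]_d) (t : {linear Y -> R^o})
    (x : 'rV[R]_d) (s : Y) : R :=
  g0 x - dot v x + t s.

Definition subproblem_optimal (R : realType) (d : nat) (Y : normedModType R)
    (K : set Y) (g0 : 'rV[R]_d -> R) (G H : 'rV[R]_d -> Y) (Q : set 'rV[R]_d)
    (x0 v : 'rV[R]_d) (t : {linear Y -> R^o}) (x : 'rV[R]_d) (s : Y) : Prop :=
  subproblem_feasible K G H Q x0 x s /\
  forall x' s', subproblem_feasible K G H Q x0 x' s' ->
    subproblem_objective g0 v t x s <= subproblem_objective g0 v t x' s'.

(* [x], [v], [s], [t] are the infinite sequences produced without stopping;
   [s 0] plays no role. *)
Record exact_penalty_DCA (R : realType) (d : nat) (Y : normedModType R)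
    (K : set Y) (g0 h0 : 'rV[R]_d -> R) (G H : 'rV[R]_d -> Y)
    (Q : set 'rV[R]_d) (tau_max : \bar R) (mu kappa : R)
    (x v : nat -> 'rV[R]_d) (s : nat -> Y) (t : nat -> {linear Y -> R^o})
    : Prop := ExactPenaltyDCA {
  dca_x0 : Q (x 0%N) ;
  dca_t0 : dual_cone_pos K (t 0%N) ;
  dca_tau_max : (0 < tau_max)%E ;
  dca_mu : 1 < mu ;
  dca_kappa : 0 <= kappa ;
  dca_step1 : forall n, subdifferential h0 (x n) (v n) ;
  dca_step2 : forall n,
    subproblem_optimal K g0 G H Q (x n) (v n) (t n) (x n.+1) (s n.+1) ;
  dca_step3 : forall n y,
    t n.+1 y = if (kappa < `|s n.+1|) && ((mu * dual_norm (t n))%:E <= tau_max)%E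
               then mu * t n y else t n y
}.

Definition constraint_qualification (R : realType) (d : nat)
    (Y : normedModType R) (K : set Y) (G H : 'rV[R]_d -> Y)
    (Q : set 'rV[R]_d) (xs : 'rV[R]_d) : Prop :=
  interior [set linearized_constraint G H xs x + k | x in Q & k in K] 0.

(* Main.v *)
(* Write L_a(z) = G(z) - H(a) - DH(a)(z - a).  By Baire's theorem the constraint
   qualification gives B, r > 0 such that every y with |y| <= r lies in
   L_xs(Q n {|z| <= B}) + K; these sets are closed and convex, so the same holds,
   with a smaller r, when xs is replaced by any a close to xs.  If s_{n+1} <> 0, a
   point z of Q with L_{x_n}(z) <=_K -r s_{n+1}/|s_{n+1}| is thus available, and
   mixing it with x_{n+1} in proportion |s_{n+1}| : r gives zero slack at a cost
   O(|s_{n+1}|).  Optimality then bounds t_n(s_{n+1})/|s_{n+1}|.  Since t_n is a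
   multiple of t_0 and t_0(y) >= delta |y| on the finite-dimensional cone K, the
   multiple is bounded, so the penalty is increased finitely often and s_{n+1} = 0
   for large n; the gradient inequality for H makes x_{n+1} feasible.
   For criticality, a cluster point v of the bounded sequence v_n is a subgradient
   of h0 at xs, and comparing x_{n+1} with points perturbed in the same way shows
   that xs minimizes g0 - <v, .> over Omega(xs); a subgradient at 0 of the value
   function u |-> inf_{z in Omega(xs)} (g0 - <v, .>)(z + u) is the multiplier. *)
Require Import Defs.
From HB Require Import structures.
From mathcomp Require Import all_boot all_order all_algebra.
From mathcomp Require Import all_classical all_reals all_analysis.
From mathcomp Require Import ring lra.

Set Implicit Arguments.
Unset Strict Implicit.
Unset Printing Implicit Defensive.

Import Order.TTheory GRing.Theory Num.Theory.
Import numFieldNormedType.Exports.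

Local Open Scope classical_set_scope.
Local Open Scope ring_scope.

(** * Deciding linear identities in a module *)

Inductive mexpr (R : Type) :=
  | MVar of nat
  | MZero
  | MAdd of mexpr R & mexpr R
  | MOpp of mexpr R
  | MScale of R & mexpr R.
Arguments MVar {R}.
Arguments MZero {R}.

Section mexpr.
Context {R : pzRingType} {V : lmodType R}.

Fixpoint meval (env : seq V) (e : mexpr R) : V :=
  match e with
  | MVar i => env`_i
  | MZero => 0
  | MAdd e1 e2 => meval env e1 + meval env e2
  | MOpp e1 => - meval env e1
  | MScale a e1 => a *: meval env e1
  end.

Fixpoint mcoef (n : nat) (e : mexpr R) : R :=
  match e with
  | MVar i => if i == n then 1 else 0
  | MZero => 0
  | MAdd e1 e2 => mcoef n e1 + mcoef n e2
  | MOpp e1 => - mcoef n e1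
  | MScale a e1 => a * mcoef n e1
  end.

Fixpoint same_mcoef (n : nat) (e1 e2 : mexpr R) : Prop :=
  if n is n'.+1 then mcoef n' e1 = mcoef n' e2 /\ same_mcoef n' e1 e2 else True.

Lemma mevalE env e : meval env e = \sum_(i < size env) mcoef i e *: env`_i.
Proof.
elim: e => [j| |e1 IH1 e2 IH2|e IH|a e IH] /=; rewrite ?IH1 ?IH2 ?IH.
- have [jn|jn] := ltnP j (size env).
    rewrite (bigD1 (Ordinal jn))//= eqxx scale1r big1 ?addr0// => i ij.
    by case: eqP => [ji|]; rewrite ?scale0r//; case/eqP: ij; apply/val_inj.
  rewrite nth_default// big1// => i _.
  by rewrite gtn_eqF ?scale0r// (leq_trans _ jn).
- by rewrite big1// => i _; rewrite scale0r.
- by rewrite -big_split; apply: eq_bigr => i _; rewrite scalerDl.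
- by rewrite -sumrN; apply: eq_bigr => i _; rewrite scaleNr.
- by rewrite scaler_sumr; apply: eq_bigr => i _; rewrite scalerA.
Qed.

Lemma meval_eq env e1 e2 :
  same_mcoef (size env) e1 e2 -> meval env e1 = meval env e2.
Proof.
move=> h; rewrite !mevalE; apply: eq_bigr => i _; congr (_ *: _).
elim: (size env) h i => [_ []//|n IH /= [en /IH{}IH] i].
by have [->//|ni] := eqVneq (i : nat) n; have in' : (i < n)%N;
  [rewrite ltn_neqAle ni -ltnS ltn_ord|exact: (IH (Ordinal in'))].
Qed.

End mexpr.

(* Atoms are compared up to conversion: the same term may occur with different
   inferred structures. *)
Ltac matom env t :=
  lazymatch env with
  | [::] => constr:((0%N, [:: t]))
  | ?u :: ?env' =>
      match constr:(tt) with
      | _ => let _ := match constr:(tt) with _ => unify u t end in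
             constr:((0%N, env))
      | _ => lazymatch matom env' t with
             | (?n, ?env2) => constr:((n.+1, u :: env2))
             end
      end
  end.

Ltac mreify R env t :=
  lazymatch t with
  | (?x + ?y)%R =>
      lazymatch mreify R env x with
      | (?e1, ?env1) =>
          lazymatch mreify R env1 y with
          | (?e2, ?env2) => constr:((MAdd e1 e2, env2))
          end
      end
  | (- ?x)%R =>
      lazymatch mreify R env x with (?e, ?env1) => constr:((MOpp e, env1)) end
  | (?a *: ?x)%R =>
      lazymatch mreify R env x with (?e, ?env1) => constr:((MScale a e, env1)) end
  | 0%R => constr:((@MZero R, env))
  | _ => lazymatch matom env t with (?n, ?env1) => constr:((@MVar R n, env1)) end
  end.

Ltac module_coef R :=
  lazymatch goal with
  | |- @eq ?V ?s ?t =>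
      lazymatch mreify R (@nil V) s with
      | (?e1, ?env1) =>
          lazymatch mreify R env1 t with
          | (?e2, ?env) => apply: (@meval_eq R _ env e1 e2); rewrite /=; do ?split
          end
      end
  end.

(* Closes an equality between linear combinations by comparing the coefficients
   of each atom. *)
Ltac module R := module_coef R; ring.

(** * Convex sets and convex functions on R^d *)

Lemma convex_setP (R : realType) (M : lmodType R) (A : set M) :
  convex_set A <->
  forall (a : R) x y, 0 <= a -> a <= 1 -> A x -> A y ->
    A (a *: x + (1 - a) *: y).
Proof.
split=> [cA a x y a0 a1 Ax Ay|cA x y a].
  by have := cA x y (Itv01 a0 a1); rewrite !inE; apply.
by rewrite !inE; apply: cA; [exact: ge0|exact: le1].
Qed.

Lemma convex_functionP (R : realType) (M : lmodType R) (f : M -> R) :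
  convex_function [set: M] f <->
  forall (a : R) x y, 0 <= a -> a <= 1 ->
    f (a *: x + (1 - a) *: y) <= a * f x + (1 - a) * f y.
Proof.
split=> [cf a x y a0 a1|cf a x y _ _]; last by apply: cf; [exact: ge0|exact: le1].
by apply: (cf (Itv01 a0 a1) x y); rewrite inE.
Qed.

(** The missing weight is carried by the point 0. Induction splits off the first point and
    renormalizes the others by [1 - c ord0]. *)
Lemma convex_set_sum (R : realType) (M : lmodType R) (A : set M) (n : nat)
    (c : 'I_n -> R) (p : 'I_n -> M) :
  convex_set A -> A 0 -> (forall i, 0 <= c i) -> \sum_(i < n) c i <= 1 ->
  (forall i, A (p i)) -> A (\sum_(i < n) c i *: p i).
Proof.
move=> /convex_setP cA A0; elim: n c p => [|n IH] c p c0 c1 Ap.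
  by rewrite big_ord0.
move: c1; rewrite !big_ord_recl => c1.
have S0 : 0 <= \sum_(i < n) c (lift ord0 i) by exact: sumr_ge0.
have [c01|c01] := eqVneq (c ord0) 1.
  have cz : forall i, c (lift ord0 i) = 0.
    move=> i; apply/eqP; rewrite eq_le c0 andbT.
    have : \sum_(i < n) c (lift ord0 i) <= 0 by rewrite -(lerD2l 1) addr0 -{1}c01.
    by apply: le_trans; rewrite (bigD1 i)//= lerDl sumr_ge0.
  rewrite [X in _ + X]big1 ?addr0; last by move=> i _; rewrite cz scale0r.
  by rewrite c01 scale1r.
have cle1 : c ord0 <= 1 by rewrite (le_trans _ c1)// lerDl.
have d0 : 0 < 1 - c ord0 by rewrite subr_gt0 lt_neqAle c01.
rewrite (_ : \sum_(i < n) _ = (1 - c ord0) *: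
    \sum_(i < n) (c (lift ord0 i) / (1 - c ord0)) *: p (lift ord0 i)); last first.
  rewrite scaler_sumr; apply: eq_bigr => i _.
  by rewrite scalerA mulrC divfK// gt_eqF.
apply: cA => //; apply: IH => // [i|]; first by rewrite divr_ge0// ltW.
by rewrite -mulr_suml ler_pdivrMr// mul1r lerBrDl.
Qed.

(** The weights are [|c i| / r]; the signs of the [c i] select the vertices of a cross-polytope. *)
Lemma convex_set_sum_abs (R : realType) (M : lmodType R) (A : set M) (n : nat)
    (r : R) (c : 'I_n -> R) (b : 'I_n -> M) :
  convex_set A -> A 0 -> 0 < r -> (forall i, A (r *: b i)) ->
  (forall i, A (- r *: b i)) -> \sum_(i < n) `|c i| <= r ->
  A (\sum_(i < n) c i *: b i).
Proof.
move=> cA A0 r0 Ab ANb cr.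
rewrite (_ : \sum_(i < n) _ =
    \sum_(i < n) (`|c i| / r) *: ((Num.sg (c i) * r) *: b i)); last first.
  apply: eq_bigr => i _; rewrite scalerA; congr (_ *: _).
  rewrite [LHS]numEsg; field; exact: lt0r_neq0.
apply: convex_set_sum => // [i||i]; first by rewrite divr_ge0// ltW.
  by rewrite -mulr_suml ler_pdivrMr// mul1r.
by case: sgrP => _; rewrite ?mul0r ?mul1r ?mulN1r ?scale0r.
Qed.

Lemma ler_coord_norm (R : realType) (d : nat) (u : 'rV[R]_d) i : `|u 0 i| <= `|u|.
Proof.
rewrite [leRHS]/Num.norm/= mx_normrE.
by apply/bigmax_geP; right => /=; exists (0, i).
Qed.

(** A ball of R^d lies in the hull of finitely many points, and by monotonicity one [C] serves them
    all. *)
Lemma convex_exhaustion (R : realType) (d : nat) (A : R -> set 'rV[R]_d) :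
  (forall C, convex_set (A C)) -> {homo A : C C' / C <= C' >-> C `<=` C'} ->
  (forall u, exists C, A C u) ->
  forall B, exists C, forall u, `|u| <= B -> A C u.
Proof.
move=> cA homoA exA B.
have exs : forall s : seq 'rV[R]_d, exists C, forall u, u \in s -> A C u.
  elim=> [|v s [C HC]]; first by exists 0.
  have [C' C'v] := exA v; exists (Num.max C C') => u.
  rewrite inE => /orP[/eqP->|/HC ACu].
    by apply: (homoA _ _ _ _ C'v); rewrite le_max lexx orbT.
  by apply: (homoA _ _ _ _ ACu); rewrite le_max lexx.
(* [r] exceeds the sum of the absolute coordinates of any [u] of norm at most [B]; the added 1 keeps
   it positive. *)
pose r := d%:R * `|B| + 1.
have [C HC] := exs (0 :: [seq r *: delta_mx 0 i | i <- enum 'I_d]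
  ++ [seq - r *: delta_mx 0 i | i <- enum 'I_d]).
exists C => u uB.
have r0 : 0 < r by rewrite ltr_wpDl// mulr_ge0.
rewrite (row_sum_delta u); apply: (@convex_set_sum_abs _ _ _ _ r) => //.
- by apply: HC; rewrite inE eqxx.
- move=> i; apply: HC; rewrite inE mem_cat; apply/or3P/Or32.
  by apply/mapP; exists i => //; rewrite mem_enum.
- move=> i; apply: HC; rewrite inE mem_cat; apply/or3P/Or33.
  by apply/mapP; exists i => //; rewrite mem_enum.
apply: (@le_trans _ _ (\sum_(i < d) `|B|)).
  apply: ler_sum => i _; rewrite (le_trans (ler_coord_norm _ _))//.
  by rewrite (le_trans uB)// ler_norm.
by rewrite sumr_const card_ord -mulr_natl lerDl.
Qed.

Lemma convex_function_bounded_above (R : realType) (d : nat) (f : 'rV[R]_d -> R) :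
  convex_function [set: 'rV[R]_d] f ->
  forall B, exists C, forall u, `|u| <= B -> f u <= C.
Proof.
move=> /convex_functionP cf; apply: (@convex_exhaustion _ _ (fun C => [set u | f u <= C])).
- move=> C; apply/convex_setP => a x y a0 a1 /= fx fy.
  apply: le_trans (cf _ _ _ a0 a1) _.
  have : a * f x <= a * C by rewrite ler_wpM2l.
  have : (1 - a) * f y <= (1 - a) * C by rewrite ler_wpM2l// subr_ge0.
  lra.
- by move=> C C' CC' u /= /le_trans; apply.
- by move=> u; exists (f u) => /=.
Qed.

(** * The pairing on R^d *)

Section dot.
Context {R : realType} {d : nat}.
Implicit Types u v w : 'rV[R]_d.

Lemma dotDr v u w : dot v (u + w) = dot v u + dot v w.
Proof. by rewrite -big_split; apply: eq_bigr => i _; rewrite mxE mulrDr. Qed.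

Lemma dotDl v u w : dot (u + w) v = dot u v + dot w v.
Proof. by rewrite -big_split; apply: eq_bigr => i _; rewrite mxE mulrDl. Qed.

Lemma dotZr (a : R) v u : dot v (a *: u) = a * dot v u.
Proof. by rewrite mulr_sumr; apply: eq_bigr => i _; rewrite mxE mulrCA. Qed.

Lemma dotZl (a : R) v u : dot (a *: v) u = a * dot v u.
Proof. by rewrite mulr_sumr; apply: eq_bigr => i _; rewrite mxE mulrA. Qed.

Lemma dotNl v u : dot (- v) u = - dot v u.
Proof. by rewrite -sumrN; apply: eq_bigr => i _; rewrite mxE mulNr. Qed.

Lemma dotNr v u : dot v (- u) = - dot v u.
Proof. by rewrite -scaleN1r dotZr mulN1r. Qed.

Lemma dot_delta v i : dot v (delta_mx 0 i) = v 0 i.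
Proof.
rewrite /dot (bigD1 i)//= mxE !eqxx mulr1 big1 ?addr0// => j ji.
by rewrite mxE (negPf ji) andbF mulr0.
Qed.

Lemma cvg_dot {T : Type} {F : set_system T} {FF : Filter F} (f g : T -> 'rV[R]_d) v u :
  f @ F --> v -> g @ F --> u -> (dot (f i) (g i)) @[i --> F] --> dot v u.
Proof.
move=> fv gu; apply: cvg_big => [|j _]; first exact: add_continuous.
apply: cvgM.
  exact: (cvg_comp _ _ fv (@coord_continuous _ _ _ 0 j v)).
exact: (cvg_comp _ _ gu (@coord_continuous _ _ _ 0 j u)).
Qed.

End dot.

(** * Cone-convex maps *)

Section cone.
Context {R : realType} {Y : normedModType R} {K : set Y}.
Hypothesis hK : proper_cone K.

Lemma proper_cone0 : K 0.
Proof. by case: hK => _ _ _ /seteqP[_ /(_ 0 erefl)] []. Qed.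

Lemma proper_coneZ (a : R) y : 0 <= a -> K y -> K (a *: y).
Proof. by case: hK => _ _ + _; exact. Qed.

Lemma proper_coneD y z : K y -> K z -> K (y + z).
Proof.
case: hK => _ /convex_setP cK _ _ Ky Kz.
rewrite (_ : y + z = 2 *: (2^-1 *: y + (1 - 2^-1) *: z)).
  by apply: proper_coneZ => //; apply: cK => //; lra.
by rewrite (_ : 1 - 2^-1 = 2^-1); [rewrite -scalerDr scalerA divff ?scale1r|lra].
Qed.

(** Points with a majorant of norm at most [C] form a convex set growing with [C]. This one-sided
    control stands in for continuity of [G]. *)
Lemma cone_convex_majorant (d : nat) (G : 'rV[R]_d -> Y) :
  cone_convex K G -> forall B, exists C, forall u, `|u| <= B ->
  exists2 y, `|y| <= C & K (y - G u).
Proof.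
move=> cG; apply: (@convex_exhaustion _ _
  (fun C => [set u | exists2 y, `|y| <= C & K (y - G u)])).
- move=> C; apply/convex_setP => a u1 u2 a0 a1 /= [y1 y1C Ky1] [y2 y2C Ky2].
  have a'0 : 0 <= 1 - a by rewrite subr_ge0.
  exists (a *: y1 + (1 - a) *: y2).
    rewrite (le_trans (ler_normD _ _))// !normrZ !ger0_norm//.
    have : a * `|y1| <= a * C by rewrite ler_wpM2l.
    have : (1 - a) * `|y2| <= (1 - a) * C by rewrite ler_wpM2l.
    lra.
  have := proper_coneD (proper_coneD (proper_coneZ a0 Ky1) (proper_coneZ a'0 Ky2))
    (cG a u1 u2 a0 a1).
  by rewrite /cone_le; congr (K _); module R.
- by move=> C C' CC' u /= [y yC Ky]; exists y => //; exact: le_trans CC'.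
- by move=> u; exists `|G u|, (G u) => //; rewrite subrr; exact: proper_cone0.
Qed.

(* Extend the segment from [x i] through [xs] to a point [u i] at distance one
   from [xs]: convexity bounds [G xs] by [G (x i)] up to an error of order
   [`|x i - xs|], since [G (u i)] stays bounded above for the order of [K]. *)
Lemma cone_convex_epigraph_closed (d : nat) (G : 'rV[R]_d -> Y) (T : Type)
    (F : set_system T) (PF : ProperFilter F) (x : T -> 'rV[R]_d) (y : T -> Y)
    (xs : 'rV[R]_d) (ys : Y) :
  cone_convex K G -> x @ F --> xs -> y @ F --> ys ->
  (\forall i \near F, K (y i - G (x i))) -> K (ys - G xs).
Proof.
move=> cG xxs yys Kyx.
have [C HC] := cone_convex_majorant cG (`|xs| + 1).
pose w u : Y := xget 0 [set z | `|z| <= C /\ K (z - G u)].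
have wP u : `|u| <= `|xs| + 1 -> `|w u| <= C /\ K (w u - G u).
  by move=> /HC[z zC Kz]; rewrite /w; case: xgetP => [? -> //|/(_ z)[]].
pose l i := `|x i - xs|.
(* For [l i = 0] the inverse is 0 too, and [u i] is [xs]. *)
pose u i := xs + (l i)^-1 *: (xs - x i).
have uB i : `|u i| <= `|xs| + 1.
  rewrite (le_trans (ler_normD _ _))// lerD2l normrZ ger0_norm ?invr_ge0 /l//.
  rewrite -/(l i) distrC -/(l i); have [->|l0] := eqVneq (l i) 0; first by rewrite mulr0.
  by rewrite mulVf.
have l0 : l @ F --> (0 : R).
  by rewrite -(normr0 'rV[R]_d) -(subrr xs); apply: cvg_norm; apply: cvgB => //; exact: cvg_cst.
have lw0 : (l i *: w (u i)) @[i --> F] --> (0 : Y).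
  apply/norm_cvg0P; apply: (@squeeze_cvgr _ _ _ _ (cst 0) (fun i => l i * C)).
  - by apply: nearW => j /=; rewrite normr_ge0 normrZ normr_id ler_wpM2l//; have [] := wP _ (uB j).
  - exact: cvg_cst.
  - by rewrite -[0 in X in _ --> X](mul0r C); apply: cvgM => //; exact: cvg_cst.
case: hK => cK _ _ _.
apply: (@closed_cvg _ _ F _
  (fun i => (y i + l i *: w (u i)) - (G xs + l i *: G xs)) K) => //; last first.
  rewrite -[ys]addr0 -[G xs in X in _ --> X]addr0.
  apply: cvgB; apply: cvgD => //; first exact: cvg_cst.
  by rewrite -[0 in X in _ --> X](scale0r (G xs)); exact: cvgZr_tmp.
near=> i.
have Kyi : K (y i - G (x i)) by near: i.
have [_ Kw] := wP _ (uB i).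
have l_ge0 : 0 <= l i by rewrite /l.
have l1 : 0 < 1 + l i by rewrite ltr_wpDr.
pose a := (1 + l i)^-1.
have a0 : 0 <= a by rewrite invr_ge0 ltW.
have a1 : a <= 1 by rewrite invf_le1// lerDl.
have aE : (1 + l i) * a = 1 by rewrite mulfV// gt_eqF.
have bE : (1 + l i) * (1 - a) = l i by rewrite mulrBr aE mulr1 addrAC subrr add0r.
have xsE : a *: x i + (1 - a) *: u i = xs.
  apply: (@scalerI _ _ (1 + l i)); first exact: lt0r_neq0.
  rewrite scalerDr !scalerA aE bE scale1r /u scalerDr scalerA.
  have [l00|ln0] := eqVneq (l i) 0.
    have /eqP := l00; rewrite normr_eq0 subr_eq0 => /eqP <-.
    by rewrite l00 !mul0r !scale0r !addr0 scale1r.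
  by rewrite mulfV//; module R.
have := cG a (x i) (u i) a0 a1; rewrite xsE /cone_le.
move=> /(proper_coneZ (ltW l1)).
rewrite scalerBr scalerDr !scalerA aE bE scale1r [(1 + _) *: _]scalerDl scale1r => KG.
have := proper_coneD (proper_coneD Kyi (proper_coneZ l_ge0 Kw)) KG.
by congr (K _); module R.
Unshelve. all: by end_near. Qed.

Lemma cone_convex_shift_linear (d : nat) (G : 'rV[R]_d -> Y)
    (f : {linear 'rV[R]_d -> Y}) (a : 'rV[R]_d) (c : Y) :
  cone_convex K G -> cone_convex K (fun x => G x - c - f (x - a)).
Proof.
move=> cG b x1 x2 b0 b1; have := cG b x1 x2 b0 b1; rewrite /cone_le.
congr (K _); rewrite !(linearB, linearD, linearZ)/=.
module R.
Qed.

End cone.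

(** * Subgradients *)

(* Hahn-Banach, one coordinate at a time: a subgradient on the span of the first
   [k] coordinates extends to [k.+1] coordinates. *)
Lemma convex_function_subgradient0 (R : realType) (d : nat) (f : 'rV[R]_d -> R) :
  convex_function [set: 'rV[R]_d] f -> exists v, forall u, f 0 + dot v u <= f u.
Proof.
move=> /convex_functionP cf.
pose S k := [set u : 'rV[R]_d | forall i : 'I_d, (k <= i)%N -> u 0 i = 0].
suff /(_ d (leqnn d))[v vP] : forall k, (k <= d)%N ->
    exists v, forall u, S k u -> f 0 + dot v u <= f u.
  by exists v => u; apply: vP => i; rewrite leqNgt ltn_ord.
elim=> [_|k IH kd].
  exists 0 => u u0; rewrite (_ : u = 0) ?[dot _ _]big1 ?addr0//.
    by move=> i _; rewrite mxE mul0r.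
  by apply/rowP => i; rewrite u0// mxE.
have [v vP] := IH (ltnW kd).
pose j := Ordinal kd; pose e : 'rV[R]_d := delta_mx 0 j.
have SD a u1 u2 : S k u1 -> S k u2 -> S k (a *: u1 + (1 - a) *: u2).
  by move=> u10 u20 i ki; rewrite !mxE u10// u20// !mulr0 addr0.
(* A slope along [e] is admissible when it lies above [A] (negative coordinates) and below every
   quotient of [Aub] (positive coordinates); [sup A] does. *)
pose A := [set r | exists u t, [/\ S k u, 0 < t & r = (f 0 + dot v u - f (u - t *: e)) / t]].
have Aub u' t' : S k u' -> 0 < t' -> ubound A ((f (u' + t' *: e) - f 0 - dot v u') / t').
  move=> Su' t'0 _ [u [t [Su t0 ->]]].
  rewrite ler_pdivrMr// mulrAC ler_pdivlMr//.
  have tt0 : 0 < t + t' by rewrite addr_gt0.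
  (* The weight for which the two components along [e] cancel. *)
  pose a := t' / (t + t').
  have a0 : 0 <= a by rewrite divr_ge0// ltW.
  have a1 : a <= 1 by rewrite ler_pdivrMr// mul1r lerDr ltW.
  have := cf a (u - t *: e) (u' + t' *: e) a0 a1.
  rewrite (_ : a *: _ + _ = a *: u + (1 - a) *: u'); last first.
    by module_coef R; rewrite /a; field; exact: lt0r_neq0.
  move=> /(le_trans (vP _ (SD _ _ _ Su Su'))).
  rewrite dotDr !dotZr -(ler_pM2r tt0).
  have aE : a * (t + t') = t' by rewrite divfK// gt_eqF.
  have bE : (1 - a) * (t + t') = t by rewrite mulrBl aE mul1r addrK.
  have combE p q : (a * p + (1 - a) * q) * (t + t') = t' * p + t * q.
    by rewrite mulrDl (mulrAC a) (mulrAC (1 - a)) aE bE.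
  rewrite combE [in leLHS]mulrDl combE; lra.
have S0 : S k 0 by move=> i _; rewrite mxE.
have supA : has_sup A.
  split; first by exists ((f 0 + dot v 0 - f (0 - 1 *: e)) / 1), 0, 1.
  by exists ((f (0 + 1 *: e) - f 0 - dot v 0) / 1); exact: Aub.
pose al := sup A.
(* The [j]-th coefficient of [v], invisible on [S k], is replaced by [al]. *)
exists (v + (al - v 0 j) *: e) => u Su.
pose t := u 0 j; pose u0 := u - t *: e.
have Su0 : S k u0.
  move=> i; rewrite leq_eqVlt => /orP[/eqP ki|ki].
    have -> : i = j by apply/val_inj.
    by rewrite !mxE !eqxx mulr1 subrr.
  rewrite !mxE Su//= (_ : (i == j) = false) ?mulr0 ?subr0//.
  by apply/negP => /eqP ij; move: ki; rewrite ij ltnn.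
have uE : u = u0 + t *: e by rewrite subrK.
have de w : dot e w = w 0 j.
  rewrite -(dot_delta w j) /dot; apply: eq_bigr => i _; exact: mulrC.
have dotE : dot (v + (al - v 0 j) *: e) u = dot v u0 + t * al.
  rewrite dotDl {1}uE dotDr dotZr dot_delta.
  rewrite dotZl de -/t; ring.
rewrite dotE; have [t0|t0|t0] := ltgtP t 0.
- have /(sup_upper_bound supA) : A ((f 0 + dot v u0 - f (u0 - (- t) *: e)) / (- t)).
    by exists u0, (- t); split => //; rewrite oppr_gt0.
  rewrite -/al scaleNr opprK -uE ler_pdivrMr ?oppr_gt0//; lra.
- have : al <= (f (u0 + t *: e) - f 0 - dot v u0) / t.
    by apply: ge_sup; [case: supA|exact: Aub].
  rewrite -uE ler_pdivlMr//; lra.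
- by rewrite t0 mul0r addr0 uE t0 scale0r addr0; exact: vP.
Qed.

(* The value function [F u] of the minimization of [phi] over the translate of
   [Om] by [u] is convex and finite; its subgradient at 0 is the multiplier. *)
Lemma convex_constrained_min_subgradient (R : realType) (d : nat)
    (phi : 'rV[R]_d -> R) (Om : set 'rV[R]_d) (xs : 'rV[R]_d) :
  convex_function [set: 'rV[R]_d] phi -> convex_set Om -> Om xs ->
  (forall z, Om z -> phi xs <= phi z) ->
  exists2 w, subdifferential phi xs w & normal_cone Om xs (- w).
Proof.
move=> /convex_functionP cphi /convex_setP cOm Omxs xsmin.
pose E u := [set phi (z + u) | z in Om]; pose F u := inf (E u).
have infE u : has_inf (E u).
  split; first by exists (phi (xs + u)), xs.
  (* The midpoint of [z + u] and [xs - u] is that of [z] and [xs], a point of [Om], where [phi] is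
     at least [phi xs]. *)
  exists (2 * phi xs - phi (xs - u)) => _ [z Omz <-].
  have h0 : 0 <= 2^-1 :> R by lra.
  have h1 : 2^-1 <= 1 :> R by lra.
  have := cphi 2^-1 (z + u) (xs - u) h0 h1.
  rewrite (_ : _ + _ = 2^-1 *: z + (1 - 2^-1) *: xs); last by module_coef R; field.
  have := xsmin _ (cOm _ _ _ h0 h1 Omz Omxs); lra.
have Fle u z : Om z -> F u <= phi (z + u).
  by move=> Omz; apply: ge_inf; [case: (infE u)|exists z].
have F0 : F 0 = phi xs.
  apply/eqP; rewrite eq_le; apply/andP; split.
    by rewrite -[xs in leRHS]addr0; exact: Fle.
  apply: lb_le_inf; first by case: (infE 0).
  by move=> _ [z Omz <-]; rewrite addr0; exact: xsmin.
have /convex_function_subgradient0[w wP] : convex_function [set: 'rV[R]_d] F.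
  apply/convex_functionP => a u1 u2 a0 a1; apply/ler_addgt0Pr => e e0.
  have [_ [z1 Omz1 <-] z1P] := inf_adherent e0 (infE u1).
  have [_ [z2 Omz2 <-] z2P] := inf_adherent e0 (infE u2).
  apply: le_trans (Fle _ _ (cOm _ _ _ a0 a1 Omz1 Omz2)) _.
  rewrite (_ : _ + _ = a *: (z1 + u1) + (1 - a) *: (z2 + u2)); last by module R.
  apply: le_trans (cphi _ _ _ a0 a1) _.
  have : a * phi (z1 + u1) <= a * (F u1 + e) by rewrite ler_wpM2l// ltW.
  have : (1 - a) * phi (z2 + u2) <= (1 - a) * (F u2 + e).
    by rewrite ler_wpM2l ?subr_ge0// ltW.
  lra.
(* Taking [xs] in the infimum gives [F (z - xs) <= phi z]; taking [z] in it, for the normal cone,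
   gives [F (xs - z) <= phi xs]. *)
exists w => z.
  have := le_trans (wP (z - xs)) (Fle (z - xs) _ Omxs).
  by rewrite F0 [xs + _]addrC subrK.
move=> Omz; have := le_trans (wP (xs - z)) (Fle (xs - z) _ Omz).
by rewrite F0 [z + _]addrC subrK gerDl -(opprB z xs) dotNr dotNl.
Qed.

(** Otherwise the midpoint of [ys] and [f xs] would eventually separate [y i] from [f (x i)]. Stated
    for filters because limits are taken along an ultrafilter. *)
Lemma lower_semicontinuous_cvg (R : realType) (X : topologicalType) (f : X -> R)
    (T : Type) (F : set_system T) (PF : ProperFilter F) (x : T -> X) (y : T -> R)
    (xs : X) (ys : R) :
  lower_semicontinuous (EFin \o f) -> x @ F --> xs -> y @ F --> ys ->
  (\forall i \near F, f (x i) <= y i) -> f xs <= ys.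
Proof.
move=> lf xxs yys fxy; rewrite leNgt; apply/negP => ysf.
pose m := (ys + f xs) / 2.
have [|V Vxs VP] := lf xs m; first by rewrite /= lte_fin /m; lra.
have yl : \forall i \near F, y i < m by apply: (cvgr_lt _ yys); rewrite /m; lra.
have xV : \forall i \near F, V (x i) by exact: xxs.
have [i [[Vi yi] fi]] := filter_ex (filterI (filterI xV yl) fxy).
by have := VP _ Vi; rewrite /= lte_fin ltNge (le_trans fi)// ltW.
Qed.

(** By convexity the difference quotients of [H] from [a] towards [b] are below [H b - H a] for
    steps at most 1; [K] being closed, so is their limit. *)
Lemma cone_convex_gradient (R : realType) (d : nat) (Y : normedModType R)
    (K : set Y) (H : 'rV[R]_d -> Y) (a b : 'rV[R]_d) :
  proper_cone K -> cone_convex K H -> differentiable H a ->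
  K (H b - H a - 'd H a (b - a)).
Proof.
move=> hK cH dH; have [cK _ _ _] := hK.
apply: (@closed_cvg _ _ (0 : R)^'+ _ (fun h => H b - H a -
    h^-1 *: ((H \o shift a) (h *: (b - a)) - H a)) K) => //; last first.
  apply: cvgB; first exact: cvg_cst.
  rewrite -(deriveE _ dH); apply: cvg_dnbhs_at_right; exact: diff_derivable.
near=> h.
have h0 : 0 < h by [].
have h1 : h <= 1 by near: h; exact: nbhs_right_le.
have := cH h b a (ltW h0) h1; rewrite /cone_le.
have h'0 : 0 <= h^-1 by rewrite invr_ge0 ltW.
move=> /(proper_coneZ hK h'0).
rewrite (_ : (H \o shift a) (h *: (b - a)) = H (h *: b + (1 - h) *: a)); last first.
  by rewrite /=; congr H; module R.
by congr (K _); module_coef R; field; exact: lt0r_neq0.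
Unshelve. all: by end_near. Qed.

(** Compactness gives a cluster point, and an ultrafilter converges to its cluster points; no
    subsequence is extracted. *)
Lemma ultra_bounded_cvg (R : realType) (d : nat) (T : Type) (U : set_system T)
    (z : T -> 'rV[R]_d) (B : R) :
  UltraFilter U -> (\forall i \near U, `|z i| <= B) -> exists zs : 'rV[R]_d, z @ U --> zs.
Proof.
move=> UU zB; have PU : ProperFilter U by exact: ultra_proper.
have cB : compact [set u : 'rV[R]_d | `|u| <= B].
  apply: bounded_closed_compact.
    by exists B; split; [exact: num_real|move=> M BM u /= /le_trans; apply; exact: ltW].
  apply: (@preimage_closed _ _ (fun u : 'rV[R]_d => `|u|) [set r | r <= B]).
    by move=> u _; exact: norm_continuous.
  exact: closed_le.
have [zs [_ czs]] := cB (z @ U) _ zB.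
exists zs => V Vzs; rewrite nbhs_simpl/=.
have [//|UV] := in_ultra_setVsetC (z @^-1` V) UU.
by have [u []] := czs (~` V) V UV Vzs.
Qed.

(** * Coordinates on finite-dimensional sets *)

Section finite_dimensional.
Context {R : realType} {Y : normedModType R}.

Lemma continuous_lincomb (n : nat) (b : 'I_n -> Y) :
  continuous (fun c : 'rV[R]_n => \sum_(i < n) c 0 i *: b i).
Proof.
move=> c; apply: (@cvg_big _ _ _ _ _ _ _ (nbhs c)) => [|i _].
  exact: add_continuous.
by apply: (@cvgZr_tmp _ _ _ (nbhs c)); exact: coord_continuous.
Qed.

(* A spanning family of minimal cardinality is free, and the norm has a positive
   minimum on the unit sphere of the coordinates. *)
Lemma finite_dimensional_coord (A : set Y) : finite_dimensional A ->
  exists (n : nat) (b : 'I_n -> Y) (M : R), forall y, A y ->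
    exists2 c : 'rV[R]_n, `|c| <= M * `|y| & y = \sum_(i < n) c 0 i *: b i.
Proof.
move=> fA.
pose P n := exists b : 'I_n -> Y, forall y, A y ->
  exists c : 'I_n -> R, y = \sum_(i < n) c i *: b i.
have exP : exists n, `[< P n >] by have [n bP] := fA; exists n; exact/asboolP.
have [n /asboolP[b bP] nmin] := ex_minnP exP.
have bfree : forall c : 'rV[R]_n, \sum_(i < n) c 0 i *: b i = 0 -> c = 0.
  move=> c c0; apply/eqP/negPn/negP => /rV0Pn[j cj].
  suff /nmin : `[< P n.-1 >] by rewrite leqNgt prednK ?leqnn// (leq_ltn_trans _ (ltn_ord j)).
  apply/asboolP; exists (fun k => b (lift j k)) => y /bP[a ->].
  exists (fun k => a (lift j k) - a j / c 0 j * c 0 (lift j k)).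
  have bj : b j = - (c 0 j)^-1 *: \sum_(k < n.-1) c 0 (lift j k) *: b (lift j k).
    apply: (scalerI cj); rewrite scalerA mulrN mulfV// scaleN1r.
    by move/eqP: c0; rewrite (bigD1_ord j)//= addr_eq0 => /eqP.
  rewrite (bigD1_ord j)//= bj scalerA scaler_sumr -big_split/=.
  by apply: eq_bigr => k _; module R.
exists n, b.
suff [M MP] : exists M, forall c : 'rV[R]_n, `|c| <= M * `|\sum_(i < n) c 0 i *: b i|.
  exists M => y /bP[c ->]; exists (\row_i c i); last first.
    by apply: eq_bigr => i _; rewrite mxE.
  rewrite (le_trans (MP _))//; under eq_bigr do rewrite mxE; by [].
pose phi (c : 'rV[R]_n) := `|\sum_(i < n) c 0 i *: b i|.
have cphi : continuous phi.
  by move=> c; exact: (cvg_norm (@continuous_lincomb n b c)).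
pose S := [set c : 'rV[R]_n | `|c| = 1].
have Sc (c : 'rV[R]_n) : c != 0 -> S (`|c|^-1 *: c).
  by move=> c0; rewrite /S/= normrZ ger0_norm ?invr_ge0// mulVf// normr_eq0.
have [S0|/nonemptyPn S0] := pselect (S !=set0); last first.
  exists 0 => c; have [->|/Sc] := eqVneq c 0; first by rewrite normr0 mul0r.
  by rewrite S0.
have cS : compact S.
  apply: bounded_closed_compact.
    by exists 1; split; [exact: num_real|move=> M M1 u /= ->; exact: ltW].
  apply: (@preimage_closed _ _ (fun u : 'rV[R]_n => `|u|) [set r | r = 1]).
    by move=> u _; exact: norm_continuous.
  exact: closed_eq.
have [c0 c0S c0min] := compact_EVT_min S0 cS (continuous_subspaceT cphi).
have phi0 : 0 < phi c0.
  rewrite normr_gt0; apply/eqP => /bfree c00.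
  by move: c0S; rewrite inE /S/= c00 normr0 => /esym/eqP; rewrite oner_eq0.
exists (phi c0)^-1 => c; have [->|c_n0] := eqVneq c 0.
  by rewrite normr0 mulr_ge0// invr_ge0 ltW.
rewrite ler_pdivlMl//.
have := c0min _ (mem_set (Sc _ c_n0)).
rewrite /phi; under [in leRHS]eq_bigr do rewrite mxE -scalerA.
rewrite -scaler_sumr normrZ ger0_norm ?invr_ge0// ler_pdivlMl ?normr_gt0//.
by rewrite mulrC.
Qed.

(** [t] is positive on the unit vectors of [K], the image under [L] of a compact set of coordinates;
    [del] is its minimum there. *)
Lemma dual_cone_pos_coercive (K : set Y) (t : {linear Y -> R^o}) :
  proper_cone K -> finite_dimensional K -> dual_cone_pos K t ->
  exists2 del : R, 0 < del & forall y, K y -> del * `|y| <= t y.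
Proof.
move=> hK /finite_dimensional_coord[n [b [M bM]]] [[ct _] tpos].
have [cK _ _ _] := hK.
pose L (c : 'rV[R]_n) := \sum_(i < n) c 0 i *: b i.
pose D := [set c : 'rV[R]_n | `|c| <= M] `&` (L @^-1` K `&` [set c | `|L c| = 1]).
have exD y : K y -> y != 0 -> exists2 c, D c & `|y| *: L c = y.
  move=> Ky y0; have ny : `| `|y|^-1 *: y| = 1.
    by rewrite normrZ ger0_norm ?invr_ge0// mulVf// normr_eq0.
  have Ky' : K (`|y|^-1 *: y) by apply: proper_coneZ => //; rewrite invr_ge0.
  have [c cM yE] := bM _ Ky'; exists c.
    split; first by rewrite /= (le_trans cM)// ny mulr1.
    by split; rewrite /= /L -yE.
  by rewrite /L -yE scalerA mulfV ?normr_eq0// scale1r.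
have [D0|/nonemptyPn D0] := pselect (D !=set0); last first.
  exists 1 => // y Ky; have [->|/(exD _ Ky)[c]] := eqVneq y 0; last by rewrite D0.
  by rewrite normr0 mulr0 linear0.
have cL : continuous L by exact: continuous_lincomb.
have cD : compact D.
  apply: bounded_closed_compact.
    by exists M; split; [exact: num_real|move=> r Mr u [/= + _] => /le_trans; apply; exact: ltW].
  apply: closedI; last apply: closedI.
  - apply: (@preimage_closed _ _ (fun u : 'rV[R]_n => `|u|) [set r | r <= M]).
      by move=> u _; exact: norm_continuous.
    exact: closed_le.
  - by apply: preimage_closed => // c _; exact: cL.
  - apply: (@preimage_closed _ _ (fun u : 'rV[R]_n => `|L u|) [set r | r = 1]).
      by move=> u _; exact: (cvg_norm (cL u)).
    exact: closed_eq.
have ctL : continuous (t \o L : 'rV[R]_n -> R).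
  by move=> c; apply: continuous_comp; [exact: cL|exact: ct].
have [c0 c0D c0min] := compact_EVT_min D0 cD (continuous_subspaceT ctL).
exists (t (L c0)).
  move: c0D; rewrite inE => -[_ [Kc0 nc0]]; apply: tpos => // c00.
  by move: nc0; rewrite /= c00 normr0 => /esym/eqP; rewrite oner_eq0.
move=> y Ky; have [->|/(exD _ Ky)[c Dc yE]] := eqVneq y 0.
  by rewrite normr0 mulr0 linear0.
rewrite -{2}yE linearZ/= mulrC ler_wpM2l//.
by apply: c0min; rewrite inE.
Qed.

End finite_dimensional.

(** * Uniform Slater points *)

(** A cancellation law for convex sets, through the distance to [C]. A nearest point may fail to
    exist in [Y], hence the approximate one. *)
Lemma closed_convex_ball (R : realType) (Y : normedModType R) (C : set Y) (r e : R) :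
  closed C -> convex_set C -> 0 <= e ->
  (forall y, `|y| <= r -> exists2 c, C c & `|y - c| <= e) ->
  forall y, `|y| <= r - e -> C y.
Proof.
move=> clC /convex_setP cC e0 approx y yre.
have yr : `|y| <= r by rewrite (le_trans yre)// gerBl.
apply/not_notP => nCy.
pose E := [set `|y - c| | c in C]; pose D := inf E.
have infE : has_inf E.
  split; last by exists 0 => _ [c _ <-].
  by have [c Cc _] := approx y yr; exists `|y - c|, c.
have DE c : C c -> D <= `|y - c|.
  by move=> Cc; apply: ge_inf; [case: infE|exists c].
have D0 : 0 < D.
  have /nbhs_ballP[g /= g0 gC] : nbhs y (~` C).
    by apply: open_nbhs_nbhs; split => //; exact: closed_openC.
  apply: (lt_le_trans g0); apply: lb_le_inf; first by case: infE.
  move=> _ [c Cc <-]; rewrite leNgt; apply/negP => yc.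
  by apply: (gC c) => //; rewrite -ball_normE.
(* A nearly closest point [c] of [C]; overshooting [y] from [c] up to the ball of
   radius [r] and averaging back with [c] gets strictly closer to [y]. *)
have eta0 : 0 < D ^+ 2 / (e + 1) by rewrite divr_gt0 ?exprn_gt0// ltr_wpDl.
have [_ [c Cc <-]] := inf_adherent eta0 infE.
rewrite -/D; set rho := `|y - c| => rhoD.
have Drho : D <= rho by exact: DE.
have rho0 : 0 < rho by exact: lt_le_trans D0 Drho.
pose tau := (r - `|y|) / rho.
have tau0 : 0 <= tau by rewrite divr_ge0 ?subr_ge0// ltW.
have tauE : tau * rho = r - `|y| by rewrite divfK// gt_eqF.
have [|c' Cc'] := approx (y + tau *: (y - c)).
  by rewrite (le_trans (ler_normD _ _))// normrZ ger0_norm// -/rho tauE addrC subrK.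
have t1 : 0 < 1 + tau by rewrite ltr_wpDr.
have a0 : 0 <= (1 + tau)^-1 by rewrite invr_ge0 ltW.
have a1 : (1 + tau)^-1 <= 1 by rewrite invf_le1// lerDl.
have /DE := cC _ _ _ a0 a1 Cc' Cc.
rewrite (_ : y - _ = (1 + tau)^-1 *: (y + tau *: (y - c) - c')); last first.
  by module_coef R; field; exact: lt0r_neq0.
rewrite normrZ ger0_norm// ler_pdivlMl// => Dt /(le_trans Dt){Dt}.
have De : (e + 1) * (D ^+ 2 / (e + 1)) = D ^+ 2 by rewrite mulrC divfK// gt_eqF// ltr_wpDl.
(* The bounds [(1 + tau) D <= e <= tau rho] give [D <= tau (rho - D)], so [e + 1 <= tau D] by the
   choice of tolerance; but [tau D <= e - D]. *)
nra.
Qed.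

Section slack.
Context {R : realType} {d : nat} {Y : completeNormedModType R} {K : set Y}.
Context {G H : 'rV[R]_d -> Y} {Q : set 'rV[R]_d}.
Hypotheses (hK : proper_cone K) (hG : cone_convex K G).
Hypothesis hdH : continuously_differentiable H.
Hypotheses (hQclosed : closed Q) (hQconvex : convex_set Q).

Local Notation L := (linearized_constraint G H).

(** Truncations by [B] of the set in the constraint qualification, at a general base point [a]. The
    bound supplies the compactness that makes them closed. *)
Definition slack_set (a : 'rV[R]_d) (B : R) : set Y :=
  [set y | exists z, [/\ Q z, `|z| <= B & K (y - L a z)]].

Lemma linearized_constraint_convex a : cone_convex K (L a).
Proof. exact: cone_convex_shift_linear. Qed.

Lemma slack_set_le a B B' : B <= B' -> slack_set a B `<=` slack_set a B'.
Proof. by move=> BB' y [z [Qz zB Kz]]; exists z; split => //; exact: le_trans BB'. Qed.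

Lemma slack_set_convex a B : convex_set (slack_set a B).
Proof.
apply/convex_setP => l y1 y2 l0 l1 [z1 [Qz1 z1B Kz1]] [z2 [Qz2 z2B Kz2]].
have l'0 : 0 <= 1 - l by rewrite subr_ge0.
exists (l *: z1 + (1 - l) *: z2); split.
- by have /convex_setP := hQconvex; apply.
- rewrite (le_trans (ler_normD _ _))// !normrZ !ger0_norm//.
  have : l * `|z1| <= l * B by rewrite ler_wpM2l.
  have : (1 - l) * `|z2| <= (1 - l) * B by rewrite ler_wpM2l.
  lra.
- have := proper_coneD hK (proper_coneD hK (proper_coneZ hK l0 Kz1)
    (proper_coneZ hK l'0 Kz2)) (linearized_constraint_convex a z1 z2 l0 l1).
  by rewrite /cone_le; congr (K _); module R.
Qed.

(** Points [z] chosen for nearby slacks stay bounded and converge along an ultrafilter; the limit is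
    admissible by closedness of the epigraph. *)
Lemma slack_set_closed a B : closed (slack_set a B).
Proof.
move=> y; rewrite closureEcvg => -[F PF [Fy FC]].
have [U [UU FU]] := ultraFilterLemma PF.
have PU : ProperFilter U by exact: ultra_proper.
have Uy : U --> y by move=> V /Fy /FU.
pose z (c : Y) : 'rV[R]_d := xget 0 [set z | [/\ Q z, `|z| <= B & K (c - L a z)]].
have zP : \forall c \near U, [/\ Q (z c), `|z c| <= B & K (c - L a (z c))].
  apply: FU; apply: FC => c [u uP]; rewrite /z.
  by case: xgetP => [? -> //|/(_ u)].
have zB : \forall c \near U, `|z c| <= B by apply: filterS zP => c [].
have [zs zzs] := ultra_bounded_cvg UU zB.
exists zs; split.
- apply: (@closed_cvg _ _ U _ z Q) => //.
  by apply: filterS zP => c [].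
- apply: (@closed_cvg _ _ U _ (fun c => `|z c|) [set r | r <= B]) => //.
  exact: cvg_norm.
- apply: (cone_convex_epigraph_closed hK PU (linearized_constraint_convex a) zzs Uy).
  by apply: filterS zP => c [].
Qed.

(** Countably many closed slack sets cover a ball, so by Baire one of them contains a ball around
    some [y0]; averaging with a negative multiple of [y0] recentres it at 0. *)
Lemma constraint_qualification_ball xs : constraint_qualification K G H Q xs ->
  exists B r, 0 < r /\ forall y, `|y| <= r -> slack_set xs B y.
Proof.
move=> /nbhs_ballP[r0 /= r00 r0P].
have exn y : `|y| < r0 -> exists n : nat, slack_set xs n%:R y.
  move=> yr0; have [|z Qz [k Kk yE]] := r0P y; first by rewrite -ball_normE /= sub0r normrN.
  have [n zn] : exists n : nat, `|z| <= n%:R.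
    by exists (Num.bound `|z|); rewrite ltW// archi_boundP.
  by exists n, z; split => //; rewrite -yE addrC addKr.
have [n nd] : exists n : nat, ~ dense (~` slack_set xs n%:R).
  apply/not_existsP => nd.
  have odC : forall n : nat,
      open (~` slack_set xs n%:R) /\ dense (~` slack_set xs n%:R).
    move=> n; split; first by apply: closed_openC; exact: slack_set_closed.
    by apply/not_notP; exact: nd.
  have := Baire odC; move=> /(_ (ball 0 r0)) [||y []].
  - by exists 0; exact: ballxx.
  - exact: ball_open.
  - by rewrite -ball_normE /= sub0r normrN => /exn[n ny] /(_ n I).
have [W [[y0 [oW Wy0]] WC]] := denseNE nd.
have WsubC : W `<=` slack_set xs n%:R.
  by move=> y Wy; apply/not_notP => ny; have : (W `&` ~` slack_set xs n%:R) y by []; rewrite WC.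
have /nbhs_ballP[rho /= rho0 rhoW] : nbhs y0 W by apply: open_nbhs_nbhs; split.
pose tau := r0 / (`|y0| + 1).
have y01 : 0 < `|y0| + 1 by rewrite ltr_wpDl.
have tau0 : 0 < tau by rewrite divr_gt0.
have [|m mP] := exn (- (tau *: y0)).
  rewrite normrN normrZ gtr0_norm// /tau mulrAC ltr_pdivrMr// ltr_pM2l//; lra.
(* With this [a] the centres cancel: [a *: y0 = (1 - a) *: (tau *: y0)]. *)
pose B : R := Num.max n%:R m%:R; pose a := tau / (1 + tau).
have t1 : 0 < 1 + tau by rewrite addr_gt0.
have a0 : 0 < a by rewrite divr_gt0.
have a1 : a <= 1 by rewrite ler_pdivrMr// mul1r lerDr.
exists B, (a * (rho / 2)); split; first by rewrite mulr_gt0// divr_gt0.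
move=> y yr.
have -> : y = a *: (y0 + a^-1 *: y) + (1 - a) *: (- (tau *: y0)).
  by module_coef R; rewrite /a; field; rewrite ?lt0r_neq0.
have /convex_setP := @slack_set_convex xs B; apply; rewrite ?(ltW a0)//.
- apply: (@slack_set_le xs n%:R); first by rewrite le_max lexx.
  apply: WsubC; apply: rhoW; rewrite -ball_normE /= opprD addrA subrr sub0r normrN normrZ.
  rewrite gtr0_norm ?invr_gt0// ltr_pdivrMl// (le_lt_trans yr)// ltr_pM2l//; lra.
- by apply: (@slack_set_le xs m%:R) => //; rewrite le_max lexx orbT.
Qed.

(** [G] cancels; what remains are the increments of [H] and of ['d H xs] between [a] and [xs], and
    the change of derivative applied to [z - a]. *)
Lemma linearized_constraint_near xs B e : 0 < e ->
  \forall a \near xs, forall z, `|z| <= B -> `|L a z - L xs z| <= e.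
Proof.
move=> e0; have [dH cdH] := hdH.
have cH : {for xs, continuous H} by apply: differentiable_continuous; exact: dH.
have cd : {for xs, continuous ('d H xs : 'rV[R]_d -> Y)} by exact: diff_continuous.
pose M := `|B| + `|xs| + 1.
have M0 : 0 < M by rewrite ltr_wpDl// addr_ge0.
pose g := e / (4 * M).
have g0 : 0 < g by rewrite divr_gt0// mulr_gt0.
have gM : g * M = e / 4 by rewrite /g; field; rewrite lt0r_neq0.
have e4 : 0 < e / 4 by rewrite divr_gt0.
near=> a; move=> z zB.
have H1 : `|H xs - H a| <= e / 4.
  by near: a; move: e4; have /cvgrPdist_le := cH; apply.
have H2 : `|'d H xs xs - 'd H xs a| <= e / 4.
  by near: a; move: e4; have /cvgrPdist_le := cd; apply.
have H3 u : `|'d H a u - 'd H xs u| <= g * `|u|.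
  by move: u; near: a; exact: cdH.
have H4 : `|xs - a| <= 1.
  by near: a; have /cvgrPdist_le := @cvg_id _ (nbhs xs); apply.
have -> : L a z - L xs z = (H xs - H a) - ('d H a (z - a) - 'd H xs (z - a))
     - ('d H xs xs - 'd H xs a).
  rewrite /linearized_constraint; move: ('d H a) ('d H xs) => p q.
  by rewrite !linearB/=; module R.
have za : `|z - a| <= M.
  rewrite (_ : z - a = z - xs + (xs - a)); last by module R.
  rewrite (le_trans (ler_normD _ _))// /M lerD// (le_trans (ler_normB _ _))// lerD//.
  exact: le_trans (ler_norm _).
have H5 : `|'d H a (z - a) - 'd H xs (z - a)| <= e / 4.
  by rewrite (le_trans (H3 _))// -gM ler_pM2l.
rewrite (le_trans (ler_normB _ _))//.
have := ler_normB (H xs - H a) ('d H a (z - a) - 'd H xs (z - a)); lra.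
Unshelve. all: by end_near. Qed.

(** Moving the base point from [xs] to [a] shifts the slacks by at most [r / 2], and
    [closed_convex_ball] takes this shift off the radius. *)
Lemma uniform_slater xs : constraint_qualification K G H Q xs ->
  exists B r, 0 < r /\ \forall a \near xs, forall y, `|y| <= r -> slack_set a B y.
Proof.
move=> /constraint_qualification_ball[B [r [r0 rP]]].
exists B, (r / 2); split; first by rewrite divr_gt0.
have r2 : 0 < r / 2 by rewrite divr_gt0.
have := linearized_constraint_near xs B r2; apply: filterS => a aP y yr.
apply: (@closed_convex_ball _ _ _ r (r / 2)) => //; last by move: yr; lra.
- exact: slack_set_closed.
- exact: slack_set_convex.
- exact: ltW.
move=> w /rP[z [Qz zB Kz]]; exists (w + (L a z - L xs z)).
  exists z; split => //; move: Kz; congr (K _); module R.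
by rewrite opprD addrA subrr sub0r normrN; exact: aP.
Qed.

End slack.

(** * The exact penalty DCA *)

Lemma ler_norm_coord (R : realType) (d : nat) (u : 'rV[R]_d) (C : R) :
  0 <= C -> (forall i, `|u 0 i| <= C) -> `|u| <= C.
Proof.
move=> C0 uC; rewrite [leLHS]/Num.norm/= mx_normrE.
by apply/bigmax_leP; split => // -[i j] _ /=; rewrite ord1.
Qed.

(** The product is at most [h (x n + u) - h (x n)]: convexity bounds the first term above on a ball,
    and semicontinuity keeps [h (x n)] above [h xs - 1]. *)
Lemma subgradient_dot_bound (R : realType) (d : nat) (h : 'rV[R]_d -> R)
    (x v : nat -> 'rV[R]_d) (xs : 'rV[R]_d) :
  closed_convex_fun h -> x n @[n --> \oo] --> xs ->
  (forall n, subdifferential h (x n) (v n)) ->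
  forall B, exists2 C, 0 <= C & \forall n \near \oo, forall u, `|u| <= B -> dot (v n) u <= C.
Proof.
move=> [ch lh] xxs vh B.
have [C HC] := convex_function_bounded_above ch (`|xs| + 1 + B).
exists (`|C - (h xs - 1)|) => //.
have [|V Vxs VP] := lh xs (h xs - 1); first by rewrite /= lte_fin; lra.
have xV : \forall n \near \oo, V (x n) by exact: xxs.
near=> n; move=> u uB.
have hx : h xs - 1 < h (x n) by rewrite -lte_fin; apply: VP; near: n.
have xn : `|x n - xs| <= 1.
  by rewrite distrC; near: n; have /cvgrPdist_le := xxs; apply.
have : h (x n + u) <= C.
  apply: HC; rewrite (le_trans (ler_normD _ _))// lerD// -[x n](subrK xs).
  by rewrite (le_trans (ler_normD _ _))// addrC lerD2l.
have := vh n (x n + u); rewrite [x n + u]addrC addrK.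
have := ler_norm (C - (h xs - 1)); lra.
Unshelve. all: by end_near. Qed.

Lemma subgradient_bounded (R : realType) (d : nat) (h : 'rV[R]_d -> R)
    (x v : nat -> 'rV[R]_d) (xs : 'rV[R]_d) :
  closed_convex_fun h -> x n @[n --> \oo] --> xs ->
  (forall n, subdifferential h (x n) (v n)) ->
  exists C, \forall n \near \oo, `|v n| <= C.
Proof.
move=> ch xxs vh; have [C C0 HC] := subgradient_dot_bound ch xxs vh 1.
exists C; apply: filterS HC => n vC; apply: ler_norm_coord => // i.
have e1 : `|delta_mx 0 i : 'rV[R]_d| <= 1.
  by apply: ler_norm_coord => // j; rewrite mxE normr_nat lern1 leq_b1.
rewrite ler_norml -dot_delta vC// andbT lerNl -dotNr vC//.
by rewrite normrN.
Qed.

(** The excess [p] at [z] and the reserve [rho *: p] at [zh] cancel: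
    [(1 - l) *: p = l *: (rho *: p)]. *)
Lemma slater_combination (R : realType) (d : nat) (Y : normedModType R) (K : set Y)
    (L : 'rV[R]_d -> Y) (Q : set 'rV[R]_d) (z zh : 'rV[R]_d) (p : Y) (l rho : R) :
  proper_cone K -> cone_convex K L -> convex_set Q -> 0 < rho -> l = (1 + rho)^-1 ->
  Q z -> Q zh -> K (p - L z) -> K (- (rho *: p) - L zh) ->
  Q (l *: zh + (1 - l) *: z) /\ K (0 - L (l *: zh + (1 - l) *: z)).
Proof.
move=> hK cL /convex_setP cQ rho0 lE Qz Qzh Kz Kzh.
have t1 : 0 < 1 + rho by rewrite addr_gt0.
have l0 : 0 <= l by rewrite lE invr_ge0 ltW.
have l1 : l <= 1 by rewrite lE invf_le1// lerDl ltW.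
have l'0 : 0 <= 1 - l by rewrite subr_ge0.
split; first exact: cQ.
have := proper_coneD hK (proper_coneD hK (proper_coneZ hK l'0 Kz)
  (proper_coneZ hK l0 Kzh)) (cL _ zh z l0 l1).
rewrite /cone_le; congr (K _); rewrite lE.
by module_coef R; field; exact: lt0r_neq0.
Qed.

Section exact_penalty.
Context {R : realType} {d : nat} {Y : completeNormedModType R} {K : set Y}.
Context {g0 h0 : 'rV[R]_d -> R} {G H : 'rV[R]_d -> Y} {Q : set 'rV[R]_d}.
Hypotheses (hg0 : closed_convex_fun g0) (hh0 : closed_convex_fun h0).
Hypotheses (hK : proper_cone K) (hG : cone_convex K G) (hH : cone_convex K H).
Hypothesis hdH : continuously_differentiable H.
Hypotheses (hQclosed : closed Q) (hQconvex : convex_set Q).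
Hypothesis hKfin : finite_dimensional K.
Context {mu : R} {x v : nat -> 'rV[R]_d} {s : nat -> Y}.
Context {t : nat -> {linear Y -> R^o}}.
Hypothesis hDCA : exact_penalty_DCA K g0 h0 G H Q +oo%E mu 0 x v s t.
Context {xs : 'rV[R]_d}.
Hypothesis hcvg : x n @[n --> \oo] --> xs.
Hypothesis hCQ : constraint_qualification K G H Q xs.

Local Notation L := (linearized_constraint G H).

(** The multiple of [t 0] reached at stage [n]. With zero tolerance and an infinite maximal norm, a
    nonzero slack alone triggers an increase. *)
Definition penalty_factor n := \prod_(i < n) (if 0 < `|s i.+1| then mu else 1).

Lemma penalty_factorE n y : t n y = penalty_factor n * t 0%N y.
Proof.
rewrite /penalty_factor; elim: n => [|n IH]; first by rewrite big_ord0 mul1r.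
rewrite big_ord_recr/= (dca_step3 hDCA) leey andbT.
by case: ifP => _; rewrite IH ?mulr1// mulrA [mu * _]mulrC.
Qed.

Lemma penalty_factor_ge1 n : 1 <= penalty_factor n.
Proof.
rewrite /penalty_factor; elim: n => [|n IH]; first by rewrite big_ord0.
rewrite big_ord_recr/= mulr_ege1//.
by case: ifP => // _; exact: ltW (dca_mu hDCA).
Qed.

Lemma penalty_factor_nondecreasing : {homo penalty_factor : m n / (m <= n)%N >-> m <= n}.
Proof.
apply: homo_leq => [//|m n p|n]; first exact: le_trans.
rewrite {2}/penalty_factor big_ord_recr/= ler_peMr//.
  exact: le_trans (penalty_factor_ge1 n).
by case: ifP => // _; exact: ltW (dca_mu hDCA).
Qed.

Lemma dca_mem n : Q (x n).
Proof.
case: n => [|n]; first exact: dca_x0 hDCA.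
by have [[]] := dca_step2 hDCA n.
Qed.

Lemma cvg_iterates_succ : x n.+1 @[n --> \oo] --> xs.
Proof. by rewrite (cvg_shiftS x). Qed.

Lemma dca_slack_ge0 n : K (s n.+1).
Proof. by have [[_ + _] _] := dca_step2 hDCA n; rewrite /cone_le subr0. Qed.

Lemma dca_penalty_ge0 n : 0 <= t n (s n.+1).
Proof.
rewrite penalty_factorE mulr_ge0//; last exact: (dca_t0 hDCA).1.2 (dca_slack_ge0 n).
exact: le_trans (penalty_factor_ge1 n).
Qed.

Lemma dca_optimal_le n (l : R) (z zh : 'rV[R]_d) : 0 <= l -> l <= 1 ->
  Q (l *: zh + (1 - l) *: z) -> K (0 - L (x n) (l *: zh + (1 - l) *: z)) ->
  g0 (x n.+1) - dot (v n) (x n.+1) + t n (s n.+1) <=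
    l * (g0 zh - dot (v n) zh) + (1 - l) * (g0 z - dot (v n) z).
Proof.
move=> l0 l1 Qw Kw; have [_ opt] := dca_step2 hDCA n.
have feas : subproblem_feasible K G H Q (x n) (l *: zh + (1 - l) *: z) 0.
  by split => //; rewrite /cone_le subrr; exact: proper_cone0.
have := opt _ _ feas.
rewrite /subproblem_objective linear0 addr0 dotDr !dotZr.
have := (convex_functionP _).1 hg0.1 l zh z l0 l1; lra.
Qed.

(* If [s n.+1 <> 0], moving [x n.+1] towards a Slater point by a fraction of order
   [`|s n.+1|] makes it feasible with zero slack, at a cost of the same order,
   while [t n (s n.+1)] is at least [penalty_factor n * `|s n.+1|] up to a constant. *)
Lemma penalty_factor_bounded : exists M, \forall n \near \oo,
  s n.+1 != 0 -> penalty_factor n <= M.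
Proof.
have [B [r [r0 Sl]]] := uniform_slater hK hG hdH hQclosed hQconvex hCQ.
have [Cg HCg] := convex_function_bounded_above hg0.1 B.
have [Cv Cv0 HCv] := subgradient_dot_bound hh0 hcvg (dca_step1 hDCA) (`|xs| + 1 + B).
have [del del0 Hdel] := dual_cone_pos_coercive hK hKfin (dca_t0 hDCA).
(* Bounds the cost of the Slater point [zh] minus that of [x n.+1]. *)
pose C := `|Cg - (g0 xs - 1)| + Cv.
exists (C / (r * del)).
have [|V Vxs VP] := hg0.2 xs (g0 xs - 1); first by rewrite /= lte_fin; lra.
have xV : \forall n \near \oo, V (x n.+1) by exact: cvg_iterates_succ.
have xSl : \forall n \near \oo, forall y, `|y| <= r ->
    slack_set (K := K) (G := G) (H := H) (Q := Q) (x n) B y by exact: hcvg Sl.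
near=> n; move=> sn0.
have gx : g0 xs - 1 < g0 (x n.+1) by rewrite -lte_fin; apply: VP; near: n.
have xn : `|x n.+1 - xs| <= 1.
  by rewrite distrC; near: n; have /cvgrPdist_le := cvg_iterates_succ; apply.
have xnB : `|x n.+1| <= `|xs| + 1.
  by rewrite -[x n.+1](subrK xs) (le_trans (ler_normD _ _))// addrC lerD2l.
have s0 : 0 < `|s n.+1| by rewrite normr_gt0.
(* Gives [rho *: s n.+1] norm exactly [r]. *)
pose rho := r / `|s n.+1|.
have rho0 : 0 < rho by rewrite divr_gt0.
have Sln : forall y, `|y| <= r ->
    slack_set (K := K) (G := G) (H := H) (Q := Q) (x n) B y by near: n.
have [|zh [Qzh zhB Kzh]] := Sln (- (rho *: s n.+1)).
  by rewrite normrN normrZ gtr0_norm// divfK// gt_eqF.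
have [[Kx _ Qx] _] := dca_step2 hDCA n.
pose l := (1 + rho)^-1.
have l0 : 0 <= l by rewrite invr_ge0 addr_ge0// ltW.
have l1 : l <= 1 by rewrite invf_le1 ?ltr_wpDr// ?lerDl ltW.
have [Qw Kw] := slater_combination hK (linearized_constraint_convex hG (x n)) hQconvex
  rho0 (erefl l) Qx Qzh Kx Kzh.
have := dca_optimal_le l0 l1 Qw Kw.
have dv : dot (v n) (x n.+1 - zh) <= Cv.
  have HCvn : forall u, `|u| <= `|xs| + 1 + B -> dot (v n) u <= Cv by near: n.
  by apply: HCvn; rewrite (le_trans (ler_normB _ _))// lerD.
rewrite dotDr dotNr in dv.
have gzh : g0 zh <= Cg by exact: HCg.
have := ler_norm (Cg - (g0 xs - 1)); rewrite penalty_factorE => Cabs opt_le.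
have gain : g0 zh - dot (v n) zh - (g0 (x n.+1) - dot (v n) (x n.+1)) <= C.
  by rewrite /C; lra.
have C0 : 0 <= C by rewrite /C addr_ge0.
(* Here [l * r] is [1 - l] times the norm of the slack, so the cost [l * C] of the move is at most
   [C / r] times that norm. *)
have lr : l * r <= `|s n.+1|.
  have <- : l * (rho * `|s n.+1|) = l * r by rewrite divfK// gt_eqF.
  have -> : l * (rho * `|s n.+1|) = (1 - l) * `|s n.+1|.
    have lE : l * (1 + rho) = 1 by rewrite mulVf// lt0r_neq0// addr_gt0.
    by rewrite mulrA; congr (_ * _); lra.
  by rewrite ler_piMl// gerBl.
have a0 : 0 <= penalty_factor n by exact: le_trans (penalty_factor_ge1 n).
have := ler_wpM2l a0 (Hdel _ (dca_slack_ge0 n)).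
have lC := ler_wpM2l l0 gain.
move=> as_; have {}as_ : penalty_factor n * (del * `|s n.+1|) <= l * C by lra.
rewrite ler_pdivlMr ?mulr_gt0// -(ler_pM2r s0).
have : l * r * C <= `|s n.+1| * C by rewrite ler_wpM2r.
have := ler_wpM2l (ltW r0) as_; lra.
Unshelve. all: by end_near. Qed.

(** Nonzero slacks recurring forever would drive the factor to infinity, against its bound at those
    very indices. *)
Lemma eventually_no_slack : \forall n \near \oo, s n.+1 = 0.
Proof.
have [M HM] := penalty_factor_bounded.
apply: contrapT => ns.
have often m : exists2 n, (m <= n)%N & s n.+1 != 0.
  apply: contrapT => nm; apply: ns; exists m => // n /= mn.
  by apply/eqP/negPn/negP => sn; apply: nm; exists n.
have mu0 : 0 < mu - 1 by rewrite subr_gt0 (dca_mu hDCA).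
(* Since the factor is at least 1, each increase adds at least [mu - 1]. *)
have grow k : exists n, k%:R * (mu - 1) <= penalty_factor n.
  elim: k => [|k [n kn]].
    by exists 0%N; rewrite mul0r (le_trans _ (penalty_factor_ge1 _)).
  have [m nm sm] := often n; exists m.+1.
  rewrite {1}/penalty_factor big_ord_recr/= normr_gt0 sm -/(penalty_factor m).
  have := penalty_factor_nondecreasing nm.
  have := ler_wpM2r (ltW mu0) (penalty_factor_ge1 m).
  rewrite -natr1; lra.
have [N _ HN] := HM.
have [k Mk] : exists k : nat, M < k%:R * (mu - 1).
  exists (Num.bound `|M / (mu - 1)|); rewrite -ltr_pdivrMr//.
  by rewrite (le_lt_trans (ler_norm _))// archi_boundP.
have [n kn] := grow k.
(* The bound is known only at indices with a nonzero slack, so a later one is chosen. *)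
have [m nm sm] := often (maxn n N).
move: nm; rewrite geq_max => /andP[nm Nm].
have := HN m Nm sm; rewrite leNgt => /negP; apply.
exact: lt_le_trans Mk (le_trans kn (penalty_factor_nondecreasing nm)).
Qed.

Lemma dual_norm_bounded : exists M, forall n, dual_norm (t n) <= M.
Proof.
have [m _ Hm] := eventually_no_slack.
have tE k : dual_norm (t (m + k)%N) = dual_norm (t m).
  elim: k => [|k <-]; first by rewrite addn0.
  rewrite /dual_norm; congr sup; apply: eq_imagel => y _; congr (`|_|).
  by rewrite addnS (dca_step3 hDCA) Hm ?normr0 ?ltxx//= leq_addr.
exists (\sum_(i < m.+1) `|dual_norm (t i)|) => n.
have le_sum k : (k <= m)%N -> dual_norm (t k) <= \sum_(i < m.+1) `|dual_norm (t i)|.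
  rewrite -ltnS => km; rewrite (bigD1 (Ordinal km))//=.
  by rewrite (le_trans (ler_norm _))// lerDl sumr_ge0.
have [|mn] := leqP n m; first exact: le_sum.
by rewrite -(subnKC (ltnW mn)) tE; exact: le_sum.
Qed.

(** With zero slack, [G (x n.+1)] lies below the linearization of [H] at [x n], which lies below
    [H (x n.+1)] by convexity. *)
Lemma eventually_feasible : exists m, forall n, (m <= n)%N -> feasible K G H Q (x n).
Proof.
have [m _ Hm] := eventually_no_slack.
(* The slack [s n.+1] belongs to the point [x n.+1], hence the shift. *)
exists m.+1 => -[//|n] mn; split; last exact: dca_mem.
have [[Kx _ _] _] := dca_step2 hDCA n.
move: Kx; rewrite Hm// => Kx.
have := proper_coneD hK Kx (cone_convex_gradient (x n.+1) hK hH (hdH.1 (x n))).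
rewrite /cone_le /linearized_constraint.
by move: ('d H (x n) _) => p; congr (K _); module R.
Qed.

(** [K (H (x n) - G (x n))] holds eventually and passes to the limit by continuity of [H] and
    closedness of the epigraph of [G]. *)
Lemma limit_feasible : feasible K G H Q xs.
Proof.
split; last by apply: (@closed_cvg _ _ \oo _ x Q) => //; apply: nearW => n; exact: dca_mem.
have [m Hm] := eventually_feasible.
have cH : {for xs, continuous H} by apply: differentiable_continuous; exact: hdH.1.
rewrite /cone_le sub0r opprB.
apply: (@cone_convex_epigraph_closed _ _ _ hK _ _ _ \oo _ x (fun n => H (x n))) => //.
  exact: cvg_comp hcvg cH.
exists m => // n /= /Hm[]; rewrite /cone_le sub0r opprB; by [].
Qed.

(** A point [z] feasible for the limit linearization violates the one at [x n] by a vanishing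
    amount. Weight [l] on a Slater point repairs this; [n] goes to infinity first, then [l] to 0. *)
Lemma limit_minimizes (U : set_system nat) (vs : 'rV[R]_d) :
  ProperFilter U -> \oo `<=` U -> v @ U --> vs ->
  forall z, linearized_feasible K G H Q xs z ->
    g0 xs - dot vs xs <= g0 z - dot vs z.
Proof.
move=> PU ooU vvs z [Qz Kz].
have [B [r [r0 Sl]]] := uniform_slater hK hG hdH hQclosed hQconvex hCQ.
have [Cg HCg] := convex_function_bounded_above hg0.1 B.
have [Cv Cv0 HCv] := subgradient_dot_bound hh0 hcvg (dca_step1 hDCA) B.
pose A := g0 z - dot vs z.
suff key l : 0 < l -> l < 1 ->
    g0 xs - dot vs xs <= l * (Cg + Cv) + (1 - l) * A.
  apply/ler_addgt0Pr => e e0.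
  have [l [l0 l1 le]] : exists l, [/\ 0 < l, l < 1 & l * (Cg + Cv - A) <= e].
    pose D := `|Cg + Cv - A|; have D0 : 0 <= D by rewrite /D.
    have q0 : 0 < e + D + 1 by lra.
    (* The denominator exceeds [e], so [l < 1], and [D], so [l * D <= e]. *)
    exists (e / (e + D + 1)); split; first by rewrite divr_gt0.
      by rewrite ltr_pdivrMr// mul1r; lra.
    rewrite mulrAC ler_pdivrMr// ler_pM2l//.
    by rewrite (le_trans (ler_norm _))// -/D; lra.
  by have := key l l0 l1; rewrite -/A; lra.
move=> l0 l1.
pose rho := l^-1 - 1.
have rho0 : 0 < rho by rewrite subr_gt0 invf_gt1.
have lE : l = (1 + rho)^-1 by rewrite /rho addrC subrK invrK.
have xU : x @ U --> xs by move=> V /hcvg/ooU.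
have x1U : x n.+1 @[n --> U] --> xs by move=> V /cvg_iterates_succ/ooU.
suff : g0 xs <= dot vs xs + (l * (Cg + Cv) + (1 - l) * A) by lra.
apply: (lower_semicontinuous_cvg PU hg0.2 x1U (y := fun n =>
    dot (v n) (x n.+1) + (l * (Cg + Cv) + (1 - l) * (g0 z - dot (v n) z)))).
  apply: cvgD; first exact: cvg_dot.
  apply: cvgD; first exact: cvg_cst.
  apply: cvgM; first exact: cvg_cst.
  by apply: cvgB; [exact: cvg_cst|apply: cvg_dot => //; exact: cvg_cst].
apply: ooU.
(* This tolerance makes [rho *: p] short enough for the Slater ball of radius [r]. *)
have rr : 0 < r / rho by rewrite divr_gt0.
have xp : \forall n \near \oo, forall u, `|u| <= `|z| ->
    `|L (x n) u - L xs u| <= r / rho.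
  exact: hcvg (linearized_constraint_near hdH xs `|z| rr).
have xSl : \forall n \near \oo, forall y, `|y| <= r ->
    slack_set (K := K) (G := G) (H := H) (Q := Q) (x n) B y by exact: hcvg Sl.
near=> n.
have Sln : forall y, `|y| <= r ->
    slack_set (K := K) (G := G) (H := H) (Q := Q) (x n) B y by near: n.
pose p := L (x n) z - L xs z.
have pr : `|p| <= r / rho.
  have xpn : forall u, `|u| <= `|z| -> `|L (x n) u - L xs u| <= r / rho by near: n.
  exact: xpn.
have [|zh [Qzh zhB Kzh]] := Sln (- (rho *: p)).
  by rewrite normrN normrZ gtr0_norm// -ler_pdivlMl// mulrC.
have Kp : K (p - L (x n) z) by move: Kz; rewrite /cone_le; congr (K _); rewrite /p; module R.
have [Qw Kw] := slater_combination hK (linearized_constraint_convex hG (x n)) hQconvex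
  rho0 lE Qz Qzh Kp Kzh.
have := dca_optimal_le (ltW l0) (ltW l1) Qw Kw.
have := dca_penalty_ge0 n.
have dv : dot (v n) (- zh) <= Cv.
  have HCvn : forall u, `|u| <= B -> dot (v n) u <= Cv by near: n.
  by apply: HCvn; rewrite normrN.
rewrite dotNr in dv.
have gzh : g0 zh <= Cg by exact: HCg.
have : l * (g0 zh - dot (v n) zh) <= l * (Cg + Cv) by rewrite ler_pM2l//; lra.
lra.
Unshelve. all: by end_near. Qed.

(** The multiplier [w] of the limit problem splits the cluster point [vs] into [w + vs], a
    subgradient of [g0], and the normal vector [- w]. *)
Lemma limit_critical : critical K g0 h0 G H Q xs.
Proof.
have [U [UU ooU]] := ultraFilterLemma (@eventually_filter).
have PU : ProperFilter U by exact: ultra_proper.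
have [C HC] := subgradient_bounded hh0 hcvg (dca_step1 hDCA).
have [vs vvs] := ultra_bounded_cvg UU (ooU _ HC).
have xU : x @ U --> xs by move=> V /hcvg/ooU.
have [Kxs Qxs] := limit_feasible.
have Om_xs : linearized_feasible K G H Q xs xs.
  split => //; move: Kxs; rewrite /cone_le /linearized_constraint subrr linear0 subr0.
  by [].
have cOm : convex_set (linearized_feasible K G H Q xs).
  apply/convex_setP => a z1 z2 a0 a1 [Qz1 Kz1] [Qz2 Kz2].
  have a'0 : 0 <= 1 - a by rewrite subr_ge0.
  split; first by have /convex_setP := hQconvex; apply.
  have := proper_coneD hK (proper_coneD hK (proper_coneZ hK a0 Kz1)
    (proper_coneZ hK a'0 Kz2)) (linearized_constraint_convex (H := H) hG xs z1 z2 a0 a1).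
  by rewrite /cone_le; congr (K _); module R.
have cphi : convex_function [set: 'rV[R]_d] (fun z => g0 z - dot vs z).
  apply/convex_functionP => a z1 z2 a0 a1.
  have := (convex_functionP _).1 hg0.1 a z1 z2 a0 a1; rewrite dotDr !dotZr; lra.
have [w wphi wN] := convex_constrained_min_subgradient cphi cOm Om_xs
  (limit_minimizes PU ooU vvs).
exists vs; split.
- move=> z.
  suff : h0 xs <= h0 z - dot vs (z - xs) by lra.
  apply: (lower_semicontinuous_cvg PU hh0.2 xU (y := fun n => h0 z - dot (v n) (z - x n))).
    apply: cvgB; first exact: cvg_cst.
    by apply: cvg_dot => //; apply: cvgB => //; exact: cvg_cst.
  by apply: nearW => n; have := dca_step1 hDCA n z; lra.
- exists (w + vs).
    by move=> z; have := wphi z; rewrite dotDl [dot vs (z - xs)]dotDr dotNr; lra.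
  by exists (- w) => //; rewrite addrAC subrr add0r.
Qed.

End exact_penalty.

Theorem theorem7 (R : realType) (d : nat) (Y : completeNormedModType R)
  (K : set Y) (g0 h0 : 'rV[R]_d -> R) (G H : 'rV[R]_d -> Y)
  (Q : set 'rV[R]_d)
  (hg0 : closed_convex_fun g0) (hh0 : closed_convex_fun h0)
  (hK : proper_cone K)
  (hG : cone_convex K G) (hH : cone_convex K H)
  (hdH : continuously_differentiable H)
  (hQclosed : closed Q) (hQconvex : convex_set Q)
  (hKfin : finite_dimensional K)
  (hcoercive : exists2 c : R, 0 <= c &
     coercive_on Q (penalty_function K g0 h0 G H c))
  (mu : R) (x v : nat -> 'rV[R]_d) (s : nat -> Y) (t : nat -> {linear Y -> R^o})
  (hDCA : exact_penalty_DCA K g0 h0 G H Q +oo%E mu 0 x v s t)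
  (xs : 'rV[R]_d) (hcvg : x n @[n --> \oo] --> xs)
  (hCQ : constraint_qualification K G H Q xs) :
  [/\ exists M : R, forall n, dual_norm (t n) <= M,
      exists m : nat, forall n, (m <= n)%N -> feasible K G H Q (x n),
      feasible K G H Q xs
    & critical K g0 h0 G H Q xs].
Proof.
split.
- exact (dual_norm_bounded hg0 hh0 hK hG hdH hQclosed hQconvex hKfin hDCA hcvg hCQ).
- exact (eventually_feasible hg0 hh0 hK hG hH hdH hQclosed hQconvex hKfin hDCA hcvg hCQ).
- exact (limit_feasible hg0 hh0 hK hG hH hdH hQclosed hQconvex hKfin hDCA hcvg hCQ).
- exact (limit_critical hg0 hh0 hK hG hH hdH hQclosed hQconvex hKfin hDCA hcvg hCQ).
Qed.
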